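(* Let $V$ be a non-negative random variable with distribution function $F_V$ and let $Y\sim\mathrm{PH}(\boldsymbol{\pi},\boldsymbol{T})$ be phase-type distributed and independent of $V$. Let $F_{VY}$ be the distribution function of the product $VY$. If $F_V\in\mathcal{A}$, then $F_{VY}\in\mathcal{A}$.
   Context: For a distribution function $F$, $\overline{F}=1-F$. A distribution function $F$ on $[0,\infty)$ is subexponential, $F\in\mathcal{S}$, if $\lim_{x\to\infty}\overline{F^{*2}}(x)/\overline{F}(x)=2$, where $F^{*2}=F*F$ is the two-fold convolution (in particular $\overline{F}(x)>0$ for all $x$). $F$ belongs to the class $\mathcal{A}$ if $F\in\mathcal{S}$ and $\limsup_{x\to\infty}\overline{F}(cx)/\overline{F}(x)<1$ for some $c>1$. $Y\sim\mathrm{PH}(\boldsymbol{\pi},\boldsymbol{T})$ means that $Y$ is the time until absorption of a time-homogeneous Markov jump process on $\{1,\dots,p,p+1\}$ with states $1,\dots,p$ transient and $p+1$ absorbing, with initial distribution $\boldsymbol{\pi}=(\pi_1,\dots,\pi_p)$ on the transient states (no mass at $p+1$) and $p\times p$ sub-intensity matrix $\boldsymbol{T}$; then $\mathbb{P}(Y>y)=\boldsymbol{\pi}e^{\boldsymbol{T}y}\boldsymbol{e}$ for $y>0$, with $\boldsymbol{e}$ the column vector of ones. *)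

(* Defs.v *)
From HB Require Import structures.
From mathcomp Require Import all_boot all_order all_algebra.
From mathcomp Require Import all_classical all_reals all_analysis.
From mathcomp Require Import measurable_realfun.

Set Implicit Arguments.
Unset Strict Implicit.
Unset Printing Implicit Defensive.

Import Order.TTheory GRing.Theory Num.Theory.
Import numFieldNormedType.Exports.

Local Open Scope classical_set_scope.
Local Open Scope ring_scope.

(* Distribution functions are elements of [cumulativeBounded 0 1]: real-valued,
   nondecreasing, right-continuous, with limits 0 at -oo and 1 at +oo. *)
Definition distribution_function (R : realType) : Type :=
  cumulativeBounded (0 : R) (1 : R).

Section distribution_function_of_rv.
Context d (T : measurableType d) (R : realType) (P : probability T R).
Variable X : {RV P >-> R}.

(* The library's [cdf] is extended-real valued. *)
Definition rcdf (r : R) : R := fine (cdf X r).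

Let rcdf_nd : nondecreasing rcdf.
Proof. by move=> a b ab; rewrite fine_le ?fin_num_measure ?cdf_nondecreasing. Qed.

Let rcdf_rc : right_continuous rcdf.
Proof.
move=> a; apply: fine_cvg.
by rewrite fineK ?fin_num_measure//; exact: cdf_right_continuous.
Qed.

HB.instance Definition _ := isCumulative.Build R _ R rcdf rcdf_nd rcdf_rc.

Let rcdfNy : rcdf @ -oo --> (0 : R).
Proof. exact/fine_cvg/cvg_cdfNy0. Qed.

Let rcdfy : rcdf @ +oo --> (1 : R).
Proof. exact/fine_cvg/cvg_cdfy1. Qed.

HB.instance Definition _ :=
  isCumulativeBounded.Build R 0 1 rcdf rcdfNy rcdfy.

Definition dist_fun : distribution_function R := rcdf : cumulativeBounded 0 1.

End distribution_function_of_rv.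
Arguments dist_fun {d T R} P X.

Section heavy_tails.
Context (R : realType).
Implicit Types F G : distribution_function R.

Definition tail (f : R -> R) (x : R) : R := 1 - f x.

Definition convolution F G (x : R) : R :=
  fine (\int[lebesgue_stieltjes_measure G]_y (F (x - y))%:E)%E.

Definition subexponential F : Prop :=
  [/\ forall x : R, x < 0 -> F x = 0,
      forall x, 0 < tail F x &
      tail (convolution F F) x / tail F x @[x --> +oo] --> (2 : R)].

Definition classA F : Prop :=
  subexponential F /\
  exists2 c : R, 1 < c &
    (limf_esup (fun x : R => (tail F (c * x) / tail F x)%:E) +oo%R < 1)%E.

End heavy_tails.

Definition independent_rv d (T : measurableType d) (R : realType)
    (P : probability T R) (X Y : {RV P >-> R}) : Prop :=
  forall A B : set (measurableTypeR R), measurable A -> measurable B ->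
    P (X @^-1` A `&` Y @^-1` B) = (P (X @^-1` A) * P (Y @^-1` B))%E.
Arguments independent_rv {d T R} P X Y.

Section markov_jump_process.
Context (R : realType) (n : nat) d (Omega : measurableType d).
(* [Pr i] is the law under which the process starts in state [i]. The process is
   indexed by [R], but only its values at nonnegative times are constrained. *)
Variables (Pr : 'I_n -> probability Omega R) (X : R -> Omega -> 'I_n).

Definition past (s : R) : set (set Omega) :=
  <<s [set X u @^-1` [set k] | u in [set u | 0 <= u <= s] & k in [set: 'I_n]] >>.

(* Time-homogeneous Markov jump process with state space ['I_n] and intensity
   matrix [Q]; the last two clauses are the time-homogeneous Markov property and
   the definition of the intensities as the right derivatives at 0 of the
   transition probabilities [Pr i (X h = j)]. *)
Definition markov_jump_process (Q : 'M[R]_n) : Prop :=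
  [/\ forall (t : R) j, 0 <= t -> measurable (X t @^-1` [set j]),
      (forall w (t : R), 0 <= t -> \forall s \near t^'+, X s w = X t w) /\
      (forall w (t : R), 0 < t -> exists j, \forall s \near t^'-, X s w = j),
      forall i, Pr i (X 0 @^-1` [set i]) = 1%E,
      forall i (s h : R) A k j, 0 <= s -> 0 <= h -> past s A ->
        Pr i (A `&` X s @^-1` [set k] `&` X (s + h) @^-1` [set j]) =
        (Pr i (A `&` X s @^-1` [set k]) * Pr k (X h @^-1` [set j]))%E &
      forall i j,
        (fine (Pr i (X h @^-1` [set j])) - (i == j)%:R) / h @[h --> 0^'+]
          --> Q i j].

(* Started in [i], the process almost surely has a finite last visit to [i]. *)
Definition transient (i : 'I_n) : Prop :=
  {ae Pr i, forall w, exists M : R, forall t : R, M <= t -> X t w != i}.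

(* First hitting time of [a], equal to +oo if [a] is never reached. *)
Definition hitting_time (a : 'I_n) (w : Omega) : \bar R :=
  ereal_inf [set t%:E | t in [set t | 0 <= t /\ X t w = a]].

End markov_jump_process.

Section phase_type.
Context (R : realType) (p : nat).

Definition sub_intensity (T : 'M[R]_p) : Prop :=
  [/\ forall i, T i i < 0,
      forall i j, i != j -> 0 <= T i j &
      forall i, \sum_j T i j <= 0].

(* The states 1, ..., p are the [lshift 1 i], and the state p + 1 is
   [rshift p ord0]; the exit rates complete the rows to sum 0, and the zero row
   makes p + 1 absorbing. *)
Definition full_intensity (T : 'M[R]_p) : 'M[R]_(p + 1) :=
  block_mx T (- (T *m const_mx 1)) 0 0.

Definition initial_distribution (pi : 'rV[R]_p) : Prop :=
  (forall i, 0 <= pi 0 i) /\ \sum_i pi 0 i = 1.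

(* [mu] is the law of the absorption time under the initial distribution [pi],
   i.e. under the mixture of the laws [Pr (lshift 1 i)] with weights [pi 0 i]. *)
Definition phase_type (pi : 'rV[R]_p) (T : 'M[R]_p)
    (mu : set (measurableTypeR R) -> \bar R) : Prop :=
  [/\ initial_distribution pi, sub_intensity T &
    exists d (Omega : measurableType d)
           (Pr : 'I_(p + 1) -> probability Omega R)
           (X : R -> Omega -> 'I_(p + 1)),
      [/\ markov_jump_process Pr X (full_intensity T),
          forall i : 'I_p, transient Pr X (lshift 1 i) &
          forall B : set (measurableTypeR R), measurable B ->
            mu B = (\sum_(i < p) (pi 0 i)%:E *
              Pr (lshift 1 i)
                 (hitting_time X (rshift p ord0) @^-1` (EFin @` B)))%E]].

End phase_type.

(* Main.v *)
(** Write Fb for the tail of V, Hb for the tail of VY and [n] for the law of Y.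
    For fixed weights y, y' > 0 and z = max(y, y'), the event t < V1 y + V2 y'
    forces t - K z < V1 y, or t - K z < V2 y', or both V1, V2 > K with
    V1 + V2 > t / z.  Subexponentiality makes the last probability negligible
    against Fb (t / z) for K large; long-tailedness removes the shift K z from
    the first two when z / y is bounded, and the extra condition of class A makes
    them negligible against Fb (t / z) when z / y is large.  This gives
      P(t < V1 y + V2 y') <= (1 + e) (Fb (t / y) + Fb (t / y'))
    uniformly in y, y' <= t / M, and integrating over the weights bounds the tail
    of V1 Y1 + V2 Y2 by 2 (1 + e) Hb t + 2 P(Y > t / M).  The tail of Y decays
    exponentially while that of V does so slower than any exponential, so the
    last term is o(Hb t).  The class A condition passes to Hb by integrating
    Fb (c x) <= r Fb x in the same way.

    Exponential decay for Y: state p + 1 is absorbing because its row of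
    intensities vanishes, it is reachable from every transient state because a
    finite class of transient states cannot be closed, and then the probability
    of not being absorbed at time k N decays geometrically in k. *)

Require Import Defs.
From HB Require Import structures.
From mathcomp Require Import all_boot all_order all_algebra.
From mathcomp Require Import all_classical all_reals all_analysis.
From mathcomp Require Import measurable_realfun.
From mathcomp Require Import ring lra.

Set Implicit Arguments.
Unset Strict Implicit.
Unset Printing Implicit Defensive.

Import Order.TTheory GRing.Theory Num.Theory.
Import numFieldNormedType.Exports.

Local Open Scope classical_set_scope.
Local Open Scope ring_scope.

(** * Probabilities as real numbers *)

Definition pr (T : Type) (R : realType) (m : set T -> \bar R) (A : set T) : R :=
  fine (m A).

Section pr_lemmas.
Context d (T : measurableType d) (R : realType) (m : probability T R).
Implicit Types A B : set T.

Lemma prE A : measurable A -> m A = (pr m A)%:E.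
Proof. by move=> mA; rewrite fineK// fin_num_measure. Qed.

Lemma pr_ge0 A : 0 <= pr m A.
Proof. exact: fine_ge0. Qed.

Lemma pr_le1 A : measurable A -> pr m A <= 1.
Proof. by move=> mA; rewrite -lee_fin -prE// probability_le1. Qed.

Lemma le_pr A B : measurable A -> measurable B -> A `<=` B -> pr m A <= pr m B.
Proof. by move=> mA mB AB; rewrite -lee_fin -!prE// le_measure ?inE. Qed.

Lemma pr_setC A : measurable A -> pr m (~` A) = 1 - pr m A.
Proof.
move=> mA; apply: EFin_inj; rewrite -prE; last exact: measurableC.
by rewrite probability_setC// prE.
Qed.

Lemma pr_setT : pr m setT = 1.
Proof. by rewrite /pr probability_setT. Qed.

Lemma prU A B : measurable A -> measurable B -> [disjoint A & B] ->
  pr m (A `|` B) = pr m A + pr m B.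
Proof.
move=> mA mB AB; apply: EFin_inj; rewrite EFinD -!prE//; last exact: measurableU.
by rewrite measureU//; apply/disj_set2P.
Qed.

Lemma pr_leU A B : measurable A -> measurable B ->
  pr m (A `|` B) <= pr m A + pr m B.
Proof.
move=> mA mB; rewrite -lee_fin EFinD -!prE//; last exact: measurableU.
by rewrite measureU2.
Qed.

End pr_lemmas.

(** * Laws of random variables: tails and convolutions as probabilities *)

Section law_of_rv.
Context d (T : measurableType d) (R : realType) (P : probability T R).
Variable X : {RV P >-> R}.

Lemma tail_dist_fun t : tail (dist_fun P X) t = pr P [set w | t < X w].
Proof.
rewrite /tail /= /rcdf /cdf /distribution /pushforward -[fine _]/(pr P _).
rewrite -pr_setC; last exact: measurable_funPTI.
by congr (pr P _); apply/seteqP; split => w /=; rewrite in_itv /= ltNge => /negP.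
Qed.

(* [lebesgue_stieltjes_measure] is a measure on [measurableTypeR R], whose
   display differs from that of [R]. *)
Let X' : T -> measurableTypeR R := X.

Let mX' : measurable_fun setT X'.
Proof. exact: (measurable_funPT X). Qed.

#[local] HB.instance Definition _ := @isMeasurableFun.Build _ _ _ _ X' mX'.

(** A Stieltjes measure is determined by its values on the half-open intervals []a, b]], and there
    both sides equal the increment of the distribution function. *)
Lemma lebesgue_stieltjes_dist_fun (A : set (measurableTypeR R)) : measurable A ->
  lebesgue_stieltjes_measure (dist_fun P X) A = distribution P X' A.
Proof.
move=> mA.
apply: (lebesgue_stieltjes_measure_unique (mu := distribution P X')) => // I [[a b]]/= _ <-.
rewrite /lebesgue_stieltjes_measure /measure_extension/=.
rewrite measurable_mu_extE/=; last exact: is_ocitv.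
have [ab | ba] := leP a b; last first.
  by rewrite set_itv_ge ?wlength0 ?measure0// bnd_simp -leNgt ltW.
rewrite wlength_itv_bnd// EFinB !fineK ?fin_num_measure//.
have : `]a, b]%classic = `]-oo, b] `\` `]-oo, a] => [|->].
  by rewrite -[RHS]setCK setCD setCitvl setUC -[LHS]setCK setCitv.
rewrite (measureD (mu := distribution P X')) ?setIidr//; first exact: subset_itvl.
by rewrite -ge0_fin_numE// fin_num_measure.
Qed.

Lemma measurable_sum_gt t : measurable [set z : R * R | t < z.1 + z.2].
Proof.
rewrite -[X in measurable X]setTI; apply: measurable_fun_ltr => //.
exact: measurable_funD.
Qed.

(** The section at [y] of the complement [z.1 + z.2 <= t] has mass [F (t - y)], so the Stieltjes
    integral defining the convolution is the product measure of that complement. *)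
Lemma tail_convolution_dist_fun t :
  tail (convolution (dist_fun P X) (dist_fun P X)) t =
  pr (distribution P X \x distribution P X)%E [set z | t < z.1 + z.2].
Proof.
set m := distribution P X.
rewrite -[RHS](subKr 1) -pr_setC; last exact: measurable_sum_gt.
have mF : measurable_fun [set: R] (fun y => (dist_fun P X (t - y))%:E).
  apply/measurable_EFinP; apply: nonincreasing_measurable => //.
  by move=> x y xy; apply: cumulative_is_nondecreasing; rewrite lerB.
rewrite /tail /convolution /pr; congr (1 - fine _).
(* The laws of [X'] and [X] live on different displays; both integrals pull back to the same
   integral over [P]. *)
transitivity (\int[m]_y (dist_fun P X (t - y))%:E)%E.
  rewrite (eq_measure_integral (distribution P X')); last first.
    by move=> A mA _; exact: lebesgue_stieltjes_dist_fun.
  rewrite ge0_integral_pushforward//; last first.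
    by move=> y _; rewrite lee_fin fine_ge0.
  rewrite ge0_integral_pushforward//.
  by move=> y _; rewrite lee_fin fine_ge0.
apply: eq_integral => y _ /=; rewrite /rcdf fineK ?fin_num_measure//.
congr (m _); apply/seteqP; split => z; rewrite /xsection/= inE/= in_itv/=.
  by move=> h; apply/negP; rewrite -leNgt; lra.
by move/negP; rewrite -leNgt => h; lra.
Qed.

End law_of_rv.

Section measurable_comparison.
Context d (T : measurableType d) (R : realType).
Implicit Types f g : T -> R.

Lemma measurable_set_lt f g : measurable_fun setT f -> measurable_fun setT g ->
  measurable [set x | f x < g x].
Proof.
move=> mf mg; rewrite -[X in measurable X]setTI.
exact: (measurable_fun_ltr mf mg).
Qed.

Lemma measurable_set_le f g : measurable_fun setT f -> measurable_fun setT g ->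
  measurable [set x | f x <= g x].
Proof.
move=> mf mg; rewrite -[X in measurable X]setTI.
exact: (measurable_fun_ler mf mg).
Qed.

End measurable_comparison.

Ltac measurable_set :=
  repeat (assumption || exact: measurableT || exact: measurable_cst ||
    exact: measurable_id || exact: measurable_fst || exact: measurable_snd ||
    apply: measurable_funD || apply: measurable_funM ||
    apply: measurableX || apply: measurableU || apply: measurableI ||
    apply: measurable_set_lt || apply: measurable_set_le).

Lemma near_pinftyP (R : realType) (P : R -> Prop) :
  (\forall x \near +oo, P x) <-> exists2 M, 0 < M & forall x, M <= x -> P x.
Proof.
split=> [[M [_ MP]]|[M _ MP]].
  exists (`|M| + 1) => [|x Mx]; first by rewrite ltr_wpDl.
  by apply: MP; apply: le_lt_trans (ler_norm M) _; lra.
near=> x; apply: MP; near: x; exact: (nbhs_pinfty_ge (num_real _)).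
Unshelve. all: by end_near. Qed.

Section pr_product.
Context d1 d2 (T1 : measurableType d1) (T2 : measurableType d2) (R : realType).
Variables (m1 : probability T1 R) (m2 : probability T2 R).

Lemma pr_setX A B : measurable A -> measurable B ->
  pr (m1 \x m2)%E (A `*` B) = pr m1 A * pr m2 B.
Proof.
move=> mA mB.
by rewrite /pr product_measure1E// fineM// fin_num_measure.
Qed.

End pr_product.

(** * Subexponential laws *)

Section nonnegative_law.
Context (R : realType) (m : probability R R).

Lemma pr_gt_nincr x y : x <= y -> pr m [set v | y < v] <= pr m [set v | x < v].
Proof.
move=> xy; apply: le_pr; [measurable_set|measurable_set|].
by move=> v /=; apply: le_lt_trans.
Qed.

Lemma pr_gt_le x y : x <= y -> pr m [set v | x < v /\ v <= y] =
  pr m [set v | x < v] - pr m [set v | y < v].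
Proof.
move=> xy; rewrite (_ : [set v | x < v] =
    [set v | x < v /\ v <= y] `|` [set v | y < v]); last first.
  apply/seteqP; split => v /=; first by have [] := leP v y; [left|right].
  by move=> [[]//|]; apply: le_lt_trans.
rewrite prU ?addrK//; [measurable_set|measurable_set|].
by apply/disj_set2P/seteqP; split => v //= [[_ +]]; rewrite leNgt => /negP.
Qed.

Hypothesis m_ge0 : pr m [set v | 0 <= v] = 1.

Lemma pr_ge0_le x : 0 <= x ->
  pr m [set v | 0 <= v /\ v <= x] = 1 - pr m [set v | x < v].
Proof.
move=> x0; rewrite -m_ge0 (_ : [set v | 0 <= v] =
    [set v | 0 <= v /\ v <= x] `|` [set v | x < v]); last first.
  apply/seteqP; split => v /=; first by have [] := leP v x; [left|right].
  by move=> [[]//|/ltW]; apply: le_trans.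
rewrite prU ?addrK//; [measurable_set|measurable_set|].
by apply/disj_set2P/seteqP; split => v //= [[_ +]]; rewrite leNgt => /negP.
Qed.

(** The left-hand side is the mass of the disjoint rectangles [x < V1] and [V1 <= x < V2], both
    inside the event for nonnegative summands. This yields the lower half of the limit 2. *)
Lemma sum2_tail_ge x : 0 <= x ->
  2 * pr m [set v | x < v] - pr m [set v | x < v] * pr m [set v | x < v] <=
  pr (m \x m)%E [set z | x < z.1 + z.2].
Proof.
move=> x0.
have -> : 2 * pr m [set v | x < v] - pr m [set v | x < v] * pr m [set v | x < v] =
    pr (m \x m)%E ([set v | x < v] `*` [set v | 0 <= v] `|`
      [set v | 0 <= v /\ v <= x] `*` [set v | x < v]).
  rewrite prU ?pr_setX ?m_ge0 ?pr_ge0_le//; do ?by measurable_set.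
    by ring.
  by apply/disj_set2P/seteqP; split => -[v w] //= [[+ _] [[_ +] _]] *; simpl in *; lra.
apply: le_pr; [by measurable_set|exact: measurable_sum_gt|].
by move=> -[v w] /= [|] [] //=; lra.
Qed.

End nonnegative_law.

Section subexponential_law.
Context (R : realType) (m : probability R R).

Let Fb x := pr m [set v | x < v].
Let sum2 x := pr (m \x m)%E [set z | x < z.1 + z.2].

Hypothesis m_ge0 : pr m [set v | v < 0] = 0.
Hypothesis Fb_gt0 : forall x, 0 < Fb x.
Hypothesis Fb_cvg0 : Fb x @[x --> +oo] --> 0.
Hypothesis Fb_sub : sum2 x / Fb x @[x --> +oo] --> (2 : R).

Let Fb_near e : 0 < e -> \forall x \near +oo, Fb x <= e.
Proof.
move=> e0; near=> x.
suff : `|0 - Fb x| <= e by rewrite sub0r normrN ger0_norm ?pr_ge0.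
near: x.
move/cvgrPdist_le : Fb_cvg0; exact.
Unshelve. all: by end_near. Qed.

Let sum2_near e : 0 < e -> \forall x \near +oo, sum2 x <= (2 + e) * Fb x.
Proof.
move=> e0; near=> x.
rewrite -ler_pdivrMr//.
have : `|2 - sum2 x / Fb x| <= e.
  near: x; move/cvgrPdist_le : Fb_sub; exact.
by rewrite ler_norml => /andP[]; lra.
Unshelve. all: by end_near. Qed.

Let m_ge0T : pr m [set v | 0 <= v] = 1.
Proof.
have -> : [set v : R | 0 <= v] = ~` [set v | v < 0].
  by apply/seteqP; split => v /=; rewrite leNgt => /negP.
by rewrite pr_setC ?m_ge0 ?subr0//; measurable_set.
Qed.

Let m_ge0K K : 0 <= K -> pr m [set v | 0 <= v /\ v <= K] = 1 - Fb K.
Proof. exact: pr_ge0_le. Qed.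

(** Subexponentiality caps the mass of [x < V1 + V2] near [2 * Fb x]. Disjoint subcases already fill
    nearly all of it, which prevents [Fb (x - K)] from exceeding [Fb x] by much. *)
Lemma long_tailed K e : 0 <= K -> 0 < e ->
  \forall x \near +oo, Fb (x - K) <= (1 + e) * Fb x.
Proof.
move=> K0 e0; set k := Fb K; have k0 : 0 < k by exact: Fb_gt0.
(* The solution of [h + k = (1 + e) * (k - h)], the ratio reached at the end. *)
pose h := e * k / (2 + e).
have h0 : 0 < h by rewrite /h divr_gt0 ?mulr_gt0//; lra.
have he : h * (2 + e) = e * k by rewrite /h divfK//; lra.
have hk : h < k by nra.
near=> x.
have Kx : K <= x by near: x; exact: (nbhs_pinfty_ge (num_real _)).
have Fx : Fb x <= h by near: x; exact: Fb_near.
have Sx : sum2 x <= (2 + h) * Fb x by near: x; exact: sum2_near.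
(* x < V1, V1 <= K /\ x < V2, and K < V1 <= x /\ x - K < V2 are disjoint
   cases of x < V1 + V2. *)
have lb : Fb x + (1 - k) * Fb x + (k - Fb x) * Fb (x - K) <= sum2 x.
  have -> : Fb x + (1 - k) * Fb x + (k - Fb x) * Fb (x - K) =
    pr (m \x m)%E ([set v | x < v] `*` [set v | 0 <= v] `|`
      ([set v | 0 <= v /\ v <= K] `*` [set v | x < v] `|`
       [set v | K < v /\ v <= x] `*` [set v | x - K < v])).
    have kx : pr m [set v | K < v /\ v <= x] = k - Fb x by exact: pr_gt_le.
    rewrite !prU ?pr_setX ?m_ge0T ?m_ge0K ?kx ?mulr1 ?addrA//;
     try by measurable_set.
    - by apply/disj_set2P/seteqP; split => -[v w] //= [[[_ +] _] [[+ _] _]]; lra.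
    - by apply/disj_set2P/seteqP; split => -[v w] //= [[+ _] [[[_ +] _]|[[_ +] _]]]; lra.
  apply: le_pr.
  - by measurable_set.
  - exact: measurable_sum_gt.
  - by move=> -[v w] /= [|[|]] [] //= => [|[]|[]]; lra.
have : (k - h) * Fb (x - K) <= (h + k) * Fb x.
  have := pr_ge0 m [set v | x - K < v]; rewrite -/(Fb _) => FK.
  nra.
have : (h + k) = (1 + e) * (k - h) by lra.
move=> ->; rewrite [_ * (k - h)]mulrC -mulrA ler_pM2l//; lra.
Unshelve. all: by end_near. Qed.

(** The cases where one summand is at most [K] and the other exceeds [x] have total mass
    [2 * (1 - Fb K) * Fb x]. With [Fb K <= e / 4], only [e * Fb x] of the total [(2 + e / 2) * Fb x]
    is left for two large summands. *)
Lemma two_big_summands e : 0 < e -> exists2 K, 0 <= K & \forall x \near +oo,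
  pr (m \x m)%E [set z | [/\ x < z.1 + z.2, K < z.1 & K < z.2]] <= e * Fb x.
Proof.
move=> e0.
have [K [K0 FK]] : exists K, 0 <= K /\ Fb K <= e / 4.
  near (+oo : set_system R) => K; exists K; split.
    by near: K; exact: (nbhs_pinfty_ge (num_real _)).
  by near: K; apply: Fb_near; lra.
exists K => //; near=> x.
have Kx : K <= x by near: x; exact: (nbhs_pinfty_ge (num_real _)).
have Sx : sum2 x <= (2 + e / 2) * Fb x.
  by near: x; apply: sum2_near; lra.
set S3 := [set z : R * R | _].
have mS3 : measurable S3.
  rewrite /S3 (_ : mkset _ = [set z | x < z.1 + z.2 /\ (K < z.1 /\ K < z.2)]).
    by measurable_set.
  by apply/seteqP; split => z /= => [[]|[? []]].
have lb : (1 - Fb K) * Fb x + (Fb x * (1 - Fb K) + pr (m \x m)%E S3) <= sum2 x.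
  rewrite -(m_ge0K K0) -!pr_setX; do ?by measurable_set.
  rewrite -!prU; do ?by measurable_set.
  - apply: le_pr; [by measurable_set|exact: measurable_sum_gt|].
    by move=> -[v w] /= [|[|]] [] //=; lra.
  - apply/disj_set2P/seteqP.
    by split => -[v w] //= [[[_ +] +] [[+ [_ +]]|[_ + _]]] *; simpl in *; lra.
  - by apply/disj_set2P/seteqP; split => -[v w] //= [[+ [_ +]] [_ _ +]] *; simpl in *; lra.
have Fx := Fb_gt0 x.
nra.
Unshelve. all: by end_near. Qed.

(** By long-tailedness with shift 1, [Fb] eventually loses at most a factor [expR (l / 2)] per unit
    step. The other half of the rate [l] absorbs the constants. *)
Lemma exp_little_o_tail l e : 0 < l -> 0 < e ->
  \forall x \near +oo, expR (- (l * x)) <= e * Fb x.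
Proof.
move=> l0 e0.
pose q := expR (l / 2).
have q1 : 1 < q by rewrite /q expR_gt1; lra.
have [x0 x00 Hx0] : exists2 x0, 0 < x0 & forall y, x0 <= y -> Fb (y - 1) <= q * Fb y.
  apply/near_pinftyP; have -> : q = 1 + (q - 1) by lra.
  by apply: long_tailed; lra.
have Fn n : Fb x0 <= q ^+ n * Fb (x0 + n%:R).
  elim: n => [|n IH]; first by rewrite addr0 mul1r.
  apply: (le_trans IH); rewrite exprSr -mulrA ler_wpM2l ?exprn_ge0 ?expR_ge0//.
  have := Hx0 (x0 + n.+1%:R).
  by rewrite -natr1 addrA addrK; apply; rewrite -addrA lerDl addr_ge0.
near=> x.
have xx0 : x0 <= x by near: x; exact: (nbhs_pinfty_ge (num_real _)).
(* The part of [l * x] left after paying [l / 2] for each of at most [x - x0 + 1] unit steps. *)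
set u := l / 2 * (x + x0 - 1).
have ux : (e * Fb x0)^-1 <= u.
  rewrite /u [l / 2 * _]mulrC -ler_pdivrMr ?divr_gt0//.
  suff : (e * Fb x0)^-1 / (l / 2) - x0 + 1 <= x by lra.
  by near: x; exact: (nbhs_pinfty_ge (num_real _)).
have eF0 : 0 < e * Fb x0 by rewrite mulr_gt0.
have uF : expR (- u) <= e * Fb x0.
  rewrite expRN -[leRHS]invrK lef_pV2 ?posrE ?invr_gt0 ?expR_gt0//.
  by apply: (le_trans ux); apply: le_trans (expR_ge1Dx _); lra.
have Fx : Fb x0 <= expR (l / 2 * (x - x0 + 1)) * Fb x.
  have /truncn_itv /andP[nx xn] : 0 <= x - x0 by lra.
  apply: (le_trans (Fn (Num.truncn (x - x0)).+1)).
  rewrite /q -expRM_natr ler_pM ?expR_ge0 ?pr_ge0//.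
    rewrite ler_expR ler_wpM2l ?divr_ge0 ?(ltW l0)//.
    by move: nx; rewrite -natr1; lra.
  by apply: pr_gt_nincr; lra.
have -> : - (l * x) = - u - (l / 2 * (x - x0 + 1)) by rewrite /u; field.
rewrite expRD (expRN (l / 2 * (x - x0 + 1))) ler_pdivrMr ?expR_gt0// (le_trans uF)//.
by have := ler_wpM2l (ltW e0) Fx; rewrite mulrA mulrAC.
Unshelve. all: by end_near. Qed.

(** Each dilation by [c] gains a factor [r], so a power of [c] makes the ratio arbitrarily small.
    This is the form in which the extra condition of class A enters [weighted_sum_tail]. *)
Lemma tail_scale c r e : 1 < c -> r < 1 -> 0 < e ->
  (\forall x \near +oo, Fb (c * x) <= r * Fb x) ->
  exists2 k, 1 <= k & \forall x \near +oo, Fb (k * x) <= e * Fb x.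
Proof.
move=> c1 r1 e0 /near_pinftyP[M M0 HM].
(* Only [r < 1] is assumed; positivity of the tails gives the lower bound needed for [r ^+ n] to
   tend to 0. *)
have r0 : 0 <= r.
  have := HM M (lexx _); have := Fb_gt0 M; have := Fb_gt0 (c * M); nra.
have Hn n x : M <= x -> Fb (c ^+ n * x) <= r ^+ n * Fb x.
  move=> Mx; elim: n => [|n IH]; first by rewrite !mul1r.
  rewrite exprS -mulrA; apply: (le_trans (HM _ _)).
    by apply: (le_trans Mx); rewrite ler_peMl ?exprn_ege1 ?ltW//; lra.
  by rewrite exprS -mulrA ler_wpM2l.
have [n rn] : exists n, r ^+ n <= e.
  have : \forall n \near \oo, `|0 - r ^+ n| <= e.
    move: e e0; apply/cvgrPdist_le; apply: cvg_expr; by rewrite ger0_norm.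
  by case=> n _ /(_ n (leqnn _)) /=; rewrite sub0r normrN ger0_norm ?exprn_ge0//; exists n.
exists (c ^+ n); first by rewrite exprn_ege1// ltW.
apply/near_pinftyP; exists M => // x Mx.
by rewrite (le_trans (Hn _ _ Mx))// ler_wpM2r// pr_ge0.
Qed.

Hypothesis Fb_scale : forall e, 0 < e ->
  exists2 k, 1 <= k & \forall x \near +oo, Fb (k * x) <= e * Fb x.

Lemma weighted_sum_tail e : 0 < e -> exists2 M, 0 < M &
  forall t y y', 0 < y -> 0 < y' -> M * y <= t -> M * y' <= t ->
  pr (m \x m)%E [set z | t < z.1 * y + z.2 * y'] <=
    (1 + e) * (Fb (t / y) + Fb (t / y')).
Proof.
(* Six errors of size [h] add up: one from the factors [1 + h], two from each of the two one-summand
   bounds, and one from the case of two large summands. *)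
move=> e'0; pose h := Num.min (e / 6) 1.
have h0 : 0 < h by rewrite lt_min; lra.
have he : 6 * h <= e by rewrite mulrC -ler_pdivlMr// ge_min lexx.
have [K K0 HK] := two_big_summands h0.
have [k k1 Hk] := Fb_scale h0.
have kK0 : 0 <= k * K by rewrite mulr_ge0//; lra.
have /near_pinftyP[M M0 HM] : \forall x \near +oo, [/\
    pr (m \x m)%E [set z | [/\ x < z.1 + z.2, K < z.1 & K < z.2]] <= h * Fb x,
    Fb (k * (x - K)) <= h * Fb (x - K), Fb (x - k * K) <= (1 + h) * Fb x,
    Fb (x - K) <= (1 + 1) * Fb x & K <= x].
  have /near_pinftyP[M M0 HM] := Hk.
  near=> x; split; [by near: x| |near: x; exact: long_tailed|near: x; exact: long_tailed|
    near: x; exact: (nbhs_pinfty_ge (num_real _))].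
  apply: HM; rewrite lerBrDr; near: x; exact: (nbhs_pinfty_ge (num_real _)).
exists M => // t y y' y0 y'0 My My'.
pose z := Num.max y y'.
have z0 : 0 < z by rewrite lt_max y0.
have Mz : M * z <= t by rewrite /z; case: (leP y y').
(* [t / z] is the smaller of the two quotients, so every asymptotic bound that holds beyond [M]
   applies to both. *)
have Mx : M <= t / z by rewrite ler_pdivlMr.
have [H1 H2 _ H4 Kx] := HM _ Mx.
(* If [z / w <= k], the shift [z / w * K] is bounded and long-tailedness applies. Otherwise the
   point exceeds [k * (t / z - K)], where dilation by [k] costs a factor [h]. *)
have tM w : 0 < w -> w <= z ->
    Fb ((t - K * z) / w) <= (1 + h) * Fb (t / w) + 2 * h * Fb (t / z).
  move=> w0 wz.
  have zw1 : 1 <= z / w by rewrite ler_pdivlMr// mul1r.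
  have [zwk|kzw] := leP (z / w) k.
    have -> : (t - K * z) / w = t / w - z / w * K by rewrite mulrBl; ring.
    have [|_ _ H3 _ _] := HM (t / w).
      apply: le_trans Mx _; rewrite ler_wpM2l//; last by rewrite lef_pV2.
      by apply: le_trans Mz; rewrite mulr_ge0 ?ltW.
    rewrite (le_trans (y := Fb (t / w - k * K)))//.
      by apply: pr_gt_nincr; rewrite lerB// ler_wpM2r.
    by apply: (le_trans H3); rewrite lerDl !mulr_ge0 ?pr_ge0// ltW.
  have -> : (t - K * z) / w = (z / w) * (t / z - K).
    by field; rewrite !gt_eqF.
  rewrite (le_trans (y := Fb (k * (t / z - K))))//.
    by apply: pr_gt_nincr; rewrite ler_wpM2r ?subr_ge0// ltW.
  apply: (le_trans H2); have F0 : 0 < Fb (t / w) by [].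
  nra.
have tE w : 0 < w -> [set v | t - K * z < v * w] = [set v | (t - K * z) / w < v].
  by move=> w0; apply/seteqP; split => v /=; rewrite ltr_pdivrMr.
pose A1 := [set v | t - K * z < v * y] `*` [set: R].
pose A2 := [set: R] `*` [set v | t - K * z < v * y'].
(* [A1], [A2] and [A3] cover the event only for nonnegative summands; the null sets [N1] and [N2]
   take the rest. *)
pose A3 := [set u : R * R | t / z < u.1 + u.2 /\ (K < u.1 /\ K < u.2)].
pose N1 := [set v : R | v < 0] `*` [set: R].
pose N2 := [set: R] `*` [set v : R | v < 0].
have mA1 : measurable A1 by rewrite /A1; measurable_set.
have mA2 : measurable A2 by rewrite /A2; measurable_set.
have mA3 : measurable A3 by rewrite /A3; measurable_set.
have mN1 : measurable N1 by rewrite /N1; measurable_set.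
have mN2 : measurable N2 by rewrite /N2; measurable_set.
have := pr_leU (m \x m)%E mN1 mN2.
have := pr_leU (m \x m)%E mA1 mA2.
have := pr_leU (m \x m)%E (measurableU _ _ mA1 mA2) mA3.
have := pr_leU (m \x m)%E (measurableU _ _ (measurableU _ _ mA1 mA2) mA3)
  (measurableU _ _ mN1 mN2).
have : pr (m \x m)%E [set u | t < u.1 * y + u.2 * y'] <=
       pr (m \x m)%E (A1 `|` A2 `|` A3 `|` (N1 `|` N2)).
  apply: le_pr; [by measurable_set|by measurable_set|].
  move=> [v v'] /= tv.
  have [v0|v0] := ltP v 0; first by right; left.
  have [v'0|v'0] := ltP v' 0; first by right; right.
  left; have [vy|vy] := ltP (t - K * z) (v * y); first by left; left.
  have [vy'|vy'] := ltP (t - K * z) (v' * y'); first by left; right.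
  right; rewrite /A3/=.
  have yz : y <= z by rewrite le_max lexx.
  have yz' : y' <= z by rewrite le_max lexx orbT.
  split; first by rewrite ltr_pdivrMr//; nra.
  by split; nra.
rewrite !pr_setX; do ?by measurable_set.
rewrite !pr_setT m_ge0 !mulr1 !mul1r !tE//.
have := tM y y0; rewrite /z le_max lexx => /(_ isT); rewrite -/z => T1.
have := tM y' y'0; rewrite /z le_max lexx orbT => /(_ isT); rewrite -/z => T2.
have : pr (m \x m)%E A3 <= h * Fb (t / z).
  apply: le_trans H1; rewrite le_eqVlt; apply/orP; left; apply/eqP; congr pr.
  by apply/seteqP; split => u; [case=> ? []|case].
have Fy := Fb_gt0 (t / y); have Fy' := Fb_gt0 (t / y').
have Fz : Fb (t / z) <= Fb (t / y) + Fb (t / y').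
  by rewrite /z; case: (leP y y') => _; lra.
have Fhz := ler_wpM2l (ltW h0) Fz.
have Fhe : 6 * h * (Fb (t / y) + Fb (t / y')) <= e * (Fb (t / y) + Fb (t / y')).
  by apply: ler_wpM2r he; lra.
move: T1 T2 Fhz Fhe; rewrite /Fb.
lra.
Unshelve. all: by end_near. Qed.

End subexponential_law.

(** * Products with an independent multiplier *)

Section product_law.
Context (R : realType) (m n : probability R R).

Let h t y := pr m [set v | t < v * y].
Let Hb t := pr (m \x n)%E [set z | t < z.1 * z.2].

Lemma measurable_pr_xsection d1 d2 (T1 : measurableType d1)
    (T2 : measurableType d2) (p : probability T2 R) (A : set (T1 * T2)) :
  measurable A -> measurable_fun setT (fun x => pr p (xsection A x)).
Proof.
move=> mA; apply/measurable_EFinP.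
apply: eq_measurable_fun (measurable_fun_xsection p mA) => x _ /=.
by rewrite prE//; exact: measurable_xsection.
Qed.

(** The product measure is defined by integrating the sections at points of the first factor.
    Uniqueness on rectangles gives the other order, used to condition on the weight [y]. *)
Lemma product_measure_ysection d1 d2 (T1 : measurableType d1)
    (T2 : measurableType d2) (p1 : probability T1 R) (p2 : probability T2 R)
    (A : set (T1 * T2)) : measurable A ->
  ((p1 \x p2) A = \int[p2]_y p1 (ysection A y))%E.
Proof.
move=> mA.
rewrite -[RHS]/((p1 \x^ p2)%E A).
apply: product_measure_unique => // B C mB mC.
exact: product_measure2E.
Qed.

Lemma measurable_pr_gt_mul t : measurable_fun setT (h t).
Proof.
pose A := [set z : R * R | t < z.2 * z.1].
have mA : measurable A by rewrite /A; measurable_set.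
have := measurable_pr_xsection m mA.
apply: eq_measurable_fun => y _; congr pr.
by apply/seteqP; split => v; rewrite /xsection/= inE.
Qed.

Lemma product_tailE t : (Hb t)%:E = (\int[n]_y (h t y)%:E)%E.
Proof.
have mA : measurable [set z : R * R | t < z.1 * z.2] by measurable_set.
rewrite -prE//; apply: etrans (product_measure_ysection _ _ mA) _.
apply: eq_integral => y _.
rewrite prE//; last exact: measurable_ysection.
by congr (pr _ _)%:E; apply/seteqP; split => v; rewrite /ysection/= inE.
Qed.

(** Both sides are the probability of [t < V1 Y1 + V2 Y2]; Tonelli's theorem moves the two integrals
    over the weights outside. *)
Lemma sum_of_products_tail t :
  (\int[m \x n]_u (m \x n) [set w | (t < u.1 * u.2 + w.1 * w.2)%R] =
   \int[n]_y \int[n]_y' (m \x m) [set z | (t < z.1 * y + z.2 * y')%R])%E.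
Proof.
have mg : measurable_fun setT (fun u : R * R =>
    (m \x n)%E [set w | t < u.1 * u.2 + w.1 * w.2]).
  pose A := [set z : (R * R) * (R * R) | t < z.1.1 * z.1.2 + z.2.1 * z.2.2].
  have mA : measurable A.
    rewrite /A; apply: measurable_set_lt => //.
    by apply: measurable_funD; apply: measurable_funM; apply: measurableT_comp.
  have := measurable_fun_xsection ((m \x n)%E : probability (R * R)%type R) mA.
  apply: eq_measurable_fun => u _ /=.
  by congr ((m \x n)%E _); apply/seteqP; split => v; rewrite /xsection/= inE.
apply: etrans (fubini_tonelli2 _ mg (fun u => measure_ge0 _ _)) _.
apply: eq_integral => y _; rewrite /fubini_G/=.
transitivity (\int[m]_v \int[n]_y' m [set v' | (t < v * y + v' * y')%R])%E.
  apply: eq_integral => v _; apply: etrans (product_measure_ysection _ _ _) _.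
    by measurable_set.
  apply: eq_integral => y' _; congr (m _).
  by apply/seteqP; split => w; rewrite /ysection/= inE.
have mg' : measurable_fun setT (fun u : R * R => m [set v' | t < u.1 * y + v' * u.2]).
  pose A := [set z : (R * R) * R | t < z.1.1 * y + z.2 * z.1.2].
  have mA : measurable A.
    rewrite /A; apply: measurable_set_lt => //.
    by apply: measurable_funD; apply: measurable_funM => //; apply: measurableT_comp.
  have := measurable_fun_xsection m mA; apply: eq_measurable_fun => u _ /=.
  by congr (m _); apply/seteqP; split => v; rewrite /xsection/= inE.
(* Exchange the first summand [v] with the second weight [y']; the integrals over [v] and [v'] then
   form [m \x m]. *)
apply: etrans (fubini_tonelli _ mg' (fun u => measure_ge0 _ _)) _.
apply: eq_integral => y' _; rewrite /product_measure1.
apply: eq_integral => v _ /=; congr (m _).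
by apply/seteqP; split => w; rewrite /xsection/= inE.
Qed.

Let integral_cst_n (r : R) : (\int[n]_y r%:E = r%:E)%E.
Proof.
rewrite integral_cst// -[RHS]mule1; congr (_ * _)%E; exact: probability_setT.
Qed.

Hypothesis n_gt0 : pr n [set y | y <= 0] = 0.

(* The weights to which the bounds for large t / y do not apply. *)
Let D M t := [set y : R | y <= 0] `|` [set y | t < M * y].

Let mD M t : measurable (D M t).
Proof. by rewrite /D; measurable_set. Qed.

Let pr_D M t : pr n (D M t) <= pr n [set y | t < M * y].
Proof.
apply: le_trans (pr_leU _ _ _) _; [by measurable_set|by measurable_set|].
by rewrite n_gt0 add0r.
Qed.

Let integral_hD a M t : 0 <= a ->
  (\int[n]_y (a * h t y + \1_(D M t) y)%:E = (a * Hb t + pr n (D M t))%:E)%E.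
Proof.
move=> a0.
under eq_integral do rewrite EFinD EFinM.
rewrite ge0_integralD//.
- rewrite ge0_integralZl//.
  + rewrite -product_tailE integral_indic// setIT EFinD; congr (_ + _)%E.
    exact: prE.
  + by apply/measurable_EFinP; exact: measurable_pr_gt_mul.
  + by move=> y _; rewrite lee_fin pr_ge0.
- by move=> y _; rewrite -EFinM lee_fin mulr_ge0 ?pr_ge0.
- apply/measurable_EFinP; apply: measurable_funM => //; exact: measurable_pr_gt_mul.
- by apply/measurable_EFinP.
Qed.

(** For a weight outside [D M t] the hypothesis applies at [x = t / y]; on [D M t] the probability
    is bounded by 1, which costs the additive term. *)
Lemma product_tail_scale c r M t : 0 <= r ->
  (forall x, M <= x -> pr m [set v | c * x < v] <= r * pr m [set v | x < v]) ->
  Hb (c * t) <= r * Hb t + pr n [set y | t < M * y].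
Proof.
move=> r0 HM; rewrite -lee_fin product_tailE.
apply: (@le_trans _ _ (r * Hb t + pr n (D M t))%:E); last first.
  by rewrite lee_fin lerD2l.
rewrite -integral_hD//; apply: ge0_le_integral => //.
- by move=> y _; rewrite lee_fin pr_ge0.
- by apply/measurable_EFinP; exact: measurable_pr_gt_mul.
- apply/measurable_EFinP; apply: measurable_funD => //.
  by apply: measurable_funM => //; exact: measurable_pr_gt_mul.
move=> y _; rewrite lee_fin indicE.
have [yD|yD] := boolP (y \in D M t).
  rewrite (@le_trans _ _ 1) ?pr_le1 ?lerDr ?mulr_ge0 ?pr_ge0//; by measurable_set.
move: yD; rewrite addr0 notin_setE /D/= => /not_orP[/negP + /negP].
rewrite -ltNge -leNgt => y0 My.
have tE s : [set v | s < v * y] = [set v | s / y < v].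
  by apply/seteqP; split => v /=; rewrite ltr_pdivrMr.
by rewrite /h !tE -mulrA; apply: HM; rewrite ler_pdivlMr.
Qed.

Lemma sum_of_products_le e M t : 0 <= e ->
  (forall y y', 0 < y -> 0 < y' -> M * y <= t -> M * y' <= t ->
    pr (m \x m)%E [set z | t < z.1 * y + z.2 * y'] <=
    (1 + e) * (pr m [set v | t / y < v] + pr m [set v | t / y' < v])) ->
  (\int[n]_y \int[n]_y' (m \x m) [set z | (t < z.1 * y + z.2 * y')%R] <=
   (2 * ((1 + e) * Hb t + pr n [set y | t < M * y])%R)%:E)%E.
Proof.
move=> e0 HM.
(* The kernel is at most [a y + a y']: if either weight lies in [D M t], its indicator alone bounds
   a probability. Integrating over both weights gives twice the integral of [a]. *)
pose a y := (1 + e) * h t y + \1_(D M t) y.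
have a0 y : 0 <= a y by rewrite addr_ge0 ?mulr_ge0 ?pr_ge0 ?addr_ge0.
have ma : measurable_fun setT a.
  apply: measurable_funD => //.
  by apply: measurable_funM => //; exact: measurable_pr_gt_mul.
have Ia : (\int[n]_y (a y)%:E = ((1 + e) * Hb t + pr n (D M t))%:E)%E.
  by rewrite integral_hD ?addr_ge0.
set c := (1 + e) * Hb t + pr n (D M t) in Ia *.
have mK : measurable_fun setT (fun p : R * R =>
    (m \x m)%E [set z | t < z.1 * p.1 + z.2 * p.2]).
  pose A := [set z : (R * R) * (R * R) | t < z.2.1 * z.1.1 + z.2.2 * z.1.2].
  have mA : measurable A.
    rewrite /A; apply: measurable_set_lt => //.
    by apply: measurable_funD; apply: measurable_funM; apply: measurableT_comp.
  have := measurable_fun_xsection ((m \x m)%E : probability (R * R)%type R) mA.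
  apply: eq_measurable_fun => u _ /=.
  by congr ((m \x m)%E _); apply/seteqP; split => v; rewrite /xsection/= inE.
have Kle y y' : ((m \x m) [set z | (t < z.1 * y + z.2 * y')%R] <= (a y)%:E + (a y')%:E)%E.
  rewrite prE; last by measurable_set.
  rewrite -EFinD lee_fin.
  have [yD|yD] := boolP (y \in D M t).
    apply: (@le_trans _ _ (a y + 0)); last by rewrite lerD2l.
    rewrite addr0 /a indicE yD (@le_trans _ _ 1) ?pr_le1 ?lerDr ?mulr_ge0 ?pr_ge0 ?addr_ge0//.
    by measurable_set.
  have [yD'|yD'] := boolP (y' \in D M t).
    apply: (@le_trans _ _ (0 + a y')); last by rewrite lerD2r.
    rewrite add0r /a indicE yD' (@le_trans _ _ 1) ?pr_le1 ?lerDr ?mulr_ge0 ?pr_ge0 ?addr_ge0//.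
    by measurable_set.
  rewrite /a !indicE (negbTE yD) (negbTE yD') !addr0 -mulrDr.
  move: yD yD'; rewrite !notin_setE /D/= => /not_orP[/negP + /negP] + /not_orP[/negP + /negP].
  rewrite -!ltNge -!leNgt => y0 My y'0 My'.
  have tE s : 0 < s -> [set v | t < v * s] = [set v | t / s < v].
    by move=> s0; apply/seteqP; split => v /=; rewrite ltr_pdivrMr.
  by rewrite /h !tE//; apply: HM.
apply: (@le_trans _ _ (\int[n]_y ((a y)%:E + c%:E))%E).
  apply: ge0_le_integral => //.
  - by move=> y _; apply: integral_ge0.
  - exact: (measurable_fun_fubini_tonelli_F (m2 := n) _ mK (fun u => measure_ge0 _ _)).
  - by apply: emeasurable_funD => //; apply/measurable_EFinP.
  move=> y _.
  apply: (@le_trans _ _ (\int[n]_y' ((a y)%:E + (a y')%:E))%E).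
    apply: ge0_le_integral => //.
    + exact: (measurableT_comp mK (pair1_measurable y)).
    + by apply: emeasurable_funD => //; apply/measurable_EFinP.
  rewrite ge0_integralD//; first by rewrite integral_cst_n Ia.
  - by move=> ? _; rewrite lee_fin.
  - by move=> ? _; rewrite lee_fin.
  - exact/measurable_EFinP.
rewrite ge0_integralD//.
- rewrite integral_cst_n Ia -EFinD lee_fin /c.
  have := pr_D M t; lra.
- by move=> y _; rewrite lee_fin.
- exact/measurable_EFinP.
- by move=> y _; rewrite lee_fin addr_ge0 ?mulr_ge0 ?pr_ge0 ?addr_ge0.
Qed.

End product_law.

(** * Absorption times of Markov jump processes *)

Section pr_partition.
Context d (T : measurableType d) (R : realType) (m : probability T R).

Lemma pr_sum_preimage (n : nat) (f : T -> 'I_n) (B : set T) :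
  (forall k, measurable (f @^-1` [set k])) -> measurable B ->
  pr m B = \sum_(k < n) pr m (f @^-1` [set k] `&` B).
Proof.
move=> mf mB.
have {1}-> : B = \big[setU/set0]_(k < n) (f @^-1` [set k] `&` B).
  apply/seteqP; split => [w Bw|w]; first by rewrite (bigD1 (f w))//=; left.
  by elim/big_ind: _ => [//|A C IA IC [/IA|/IC]//|k _ []].
apply: EFin_inj; rewrite -prE; last first.
  by apply: bigsetU_measurable => k _; apply: measurableI.
rewrite measure_bigsetU_ord//=.
- rewrite -sumEFin; apply: eq_bigr => k _; rewrite prE//.
  exact: measurableI.
- by move=> k; apply: measurableI.
- by move=> i j _ _ [w [[/= <- _] [/= <- _]]].
Qed.

End pr_partition.

Section jump_process.
Context (R : realType) (n : nat) d (Omega : measurableType d).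
Variables (Pr : 'I_n -> probability Omega R) (X : R -> Omega -> 'I_n).
Variable Q : 'M[R]_n.
Hypothesis XQ : markov_jump_process Pr X Q.

Let p i j t := pr (Pr i) (X t @^-1` [set j]).

Let mX t j : 0 <= t -> measurable (X t @^-1` [set j]).
Proof. by case: XQ => + _ _ _ _; apply. Qed.

Let p_ge0 i j t : 0 <= p i j t.
Proof. exact: pr_ge0. Qed.

Let p_le1 i j t : 0 <= t -> p i j t <= 1.
Proof. by move=> t0; apply: pr_le1; exact: mX. Qed.

Let p_sum i t : 0 <= t -> \sum_j p i j t = 1.
Proof.
move=> t0; rewrite -(pr_setT (Pr i)) (@pr_sum_preimage _ _ _ _ _ (X t))//.
  by apply: eq_bigr => j _; rewrite setIT.
by move=> k; exact: mX.
Qed.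

Let p0 i : p i i 0 = 1.
Proof. by case: XQ => _ _ XQ0 _ _; rewrite /p /pr XQ0. Qed.

Let p_joint i k j s t : 0 <= s -> 0 <= t ->
  pr (Pr i) (X s @^-1` [set k] `&` X (s + t) @^-1` [set j]) = p i k s * p k j t.
Proof.
case: XQ => _ _ _ XM _ s0 t0.
(* The Markov property with the trivial past event. *)
have := XM i s t setT k j s0 t0; rewrite !setTI => E.
rewrite /p /pr E ?fineM ?fin_num_measure//; [exact: mX|exact: mX|].
by move=> G [[G0 GC _] _]; have := GC _ G0; rewrite setD0.
Qed.

Lemma chapman_kolmogorov i j s t : 0 <= s -> 0 <= t ->
  p i j (s + t) = \sum_k p i k s * p k j t.
Proof.
move=> s0 t0; rewrite [LHS](@pr_sum_preimage _ _ _ _ _ (X s)).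
- by apply: eq_bigr => k _; exact: p_joint.
- by move=> k; exact: mX.
- by apply: mX; exact: addr_ge0.
Qed.

Lemma transition_ge_mul i k j s t : 0 <= s -> 0 <= t ->
  p i k s * p k j t <= p i j (s + t).
Proof.
move=> s0 t0; rewrite chapman_kolmogorov// (bigD1 k)//= lerDl sumr_ge0//.
by move=> l _; rewrite mulr_ge0.
Qed.

Lemma absorbing_state a : Q a a = 0 -> forall t, 0 <= t -> p a a t = 1.
Proof.
move=> Qaa t t0.
apply/eqP; rewrite eq_le p_le1//=.
move: t0; rewrite [0 <= t]le_eqVlt => /orP[/eqP <-|t0]; first by rewrite p0.
apply/ler_addgt0Pr => e e0.
have /cvgrPdist_le/(_ (e / t)) Haa : (p a a h - 1) / h @[h --> 0^'+] --> (0 : R).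
  by case: XQ => _ _ _ _ /(_ a a); rewrite Qaa eqxx.
have : \forall h \near 0^'+, 1 - p a a h <= e / t * h.
  near=> h; have h0 : 0 < h by near: h; exact: nbhs_right_gt.
  have : `|0 - (p a a h - 1) / h| <= e / t by near: h; apply: Haa; exact: divr_gt0.
  rewrite sub0r normrN ler_norml => /andP[+ _].
  by rewrite ler_pdivlMr// mulNr; lra.
case=> r /= r0 Hr.
(* p_aa (t / k) ^ k >= 1 - k (1 - p_aa (t / k)), and the right-hand side is
   arbitrarily close to 1 because p_aa has right derivative 0 at 0. *)
pose k := (Num.truncn (t / r)).+1.
have k0 : 0 < k%:R :> R by rewrite ltr0n.
have tk : t / k%:R < r.
  rewrite ltr_pdivrMr// mulrC -ltr_pdivrMr//; exact: truncnS_gt.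
have h0 : 0 < t / k%:R by exact: divr_gt0.
have Hh : 1 - p a a (t / k%:R) <= e / t * (t / k%:R).
  by apply: Hr => //=; rewrite sub0r normrN gtr0_norm.
have pk l : 1 - l%:R * (e / k%:R) <= p a a (l%:R * (t / k%:R)).
  elim: l => [|l IH]; first by rewrite !mul0r subr0 p0.
  have th : 0 <= l%:R * (t / k%:R) by rewrite mulr_ge0 ?(ltW h0).
  have := transition_ge_mul a a a th (ltW h0).
  have -> : l%:R * (t / k%:R) + t / k%:R = l.+1%:R * (t / k%:R).
    by rewrite -natr1 mulrDl mul1r.
  have ek : e / t * (t / k%:R) = e / k%:R by field; rewrite !gt_eqF.
  rewrite {}ek in Hh; apply: le_trans.
  have := p_le1 a a th; have := p_le1 a a (ltW h0).
  rewrite -natr1 mulrDl mul1r; nra.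
have := pk k; rewrite mulrC divfK ?gt_eqF// mulrC divfK ?gt_eqF//; lra.
Unshelve. all: by end_near. Qed.

Lemma transition_to_absorbing_mono a i s t : Q a a = 0 -> 0 <= s -> 0 <= t ->
  p i a s <= p i a (s + t).
Proof.
move=> Qaa s0 t0; apply: le_trans (transition_ge_mul i a a s0 t0).
by rewrite absorbing_state// mulr1.
Qed.

(** Almost surely only finitely many integer times are visits to [i], so the limsup of the events
    [F k] is null. The mass of the tail unions, which bounds that of [F k], decreases to 0. *)
Lemma transient_return_cvg0 i : transient Pr X i ->
  p i i k%:R @[k --> \oo] --> 0.
Proof.
move=> Ti; pose F k := X k%:R @^-1` [set i].
have mF k : measurable (F k) by exact: mX.
have PF : Pr i (lim_sup_set F) = 0%E.
  apply: measure_negligible.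
    apply: bigcap_measurable => // k _; exact: bigcup_measurable.
  apply: negligibleS Ti => w Fw /= [M HM].
  have [k /= Mk Fk] := Fw (Num.truncn M).+1 I.
  have := HM k%:R; rewrite Fk eqxx => /(_ _)/negP; apply => //.
  by rewrite (le_trans (ltW (truncnS_gt M)))// ler_nat.
have cF : pr (Pr i) (\bigcup_(k >= N) F k) @[N --> \oo] --> (0 : R).
  apply: fine_cvg; rewrite (_ : 0%:E = Pr i (lim_sup_set F))//; apply: lim_sup_set_cvg => //.
  by rewrite ltey_eq fin_num_measure//; exact: bigcup_measurable.
apply: (squeeze_cvgr _ (cvg_cst 0) cF); near=> k; apply/andP; split => //.
by apply: le_pr; [exact: mF|exact: bigcup_measurable|exists k => /=].
Unshelve. all: by end_near. Qed.

Lemma transient_reach_absorbing a : Q a a = 0 ->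
  (forall i, i != a -> transient Pr X i) ->
  forall i, exists k : nat, 0 < p i a k%:R.
Proof.
move=> Qaa Ta i; apply: contrapT => Ni.
pose reach i j := exists k : nat, 0 < p i j k%:R.
pose S i : {set 'I_n} := [set j | `[< reach i j >]]%SET.
have SP x y : reflect (reach x y) (y \in S x).
  by rewrite finset.in_set; exact: asboolP.
have reach_trans x y z : reach x y -> reach y z -> reach x z.
  move=> [k kP] [l lP]; exists (k + l)%N; rewrite natrD.
  apply: lt_le_trans (transition_ge_mul x y z (ler0n _ k) (ler0n _ l)); exact: mulr_gt0.
pose NA x := `[< ~ reach x a >].
have Pi : NA i by exact/asboolP.
(* A state x that does not reach a and whose reachable set is minimal is reached
   back from every state it reaches, so p_jj -> 0 gives p_xj -> 0 for all j,
   although the p_xj sum to 1. *)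
case: (arg_minnP (P := NA) (fun x => #|S x|) Pi) => x /asboolP Nx xmin.
have xx : reach x x by exists 0%N; rewrite p0.
have back j : reach x j -> reach j x.
  move=> xj; have Nj : ~ reach j a by move=> ja; apply: Nx; exact: (reach_trans _ _ _ xj ja).
  have sub : S j \subset S x.
    by apply/fintype.subsetP => z /SP jz; apply/SP; exact: (reach_trans _ _ _ xj jz).
  have /eqP SE : S j == S x by rewrite eqEcard sub xmin//; exact/asboolP.
  by apply/SP; rewrite SE; exact/SP.
have pj0 j : p x j k%:R @[k --> \oo] --> 0.
  have [xj|Nxj] := pselect (reach x j); last first.
    rewrite (_ : (fun k => _) = cst 0); first exact: cvg_cst.
    apply/funext => k /=; apply/eqP; rewrite eq_le p_ge0 andbT leNgt.
    by apply/negP => pk; apply: Nxj; exists k.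
  have [l jx] := back j xj.
  have ja : j != a by apply/eqP => ja; apply: Nx; rewrite -ja.
  have := transient_return_cvg0 (Ta j ja); rewrite -(cvg_shiftn l) => cj.
  (* Going from [j] to [x] in time [l] and then back to [j] in time [k] is one way to return, so
     [p j x l * p x j k <= p j j (l + k)]. *)
  have cj' : (p j x l%:R)^-1 * p j j (k + l)%:R @[k --> \oo] --> (0 : R).
    rewrite -[X in _ --> X](mulr0 (p j x l%:R)^-1); exact: cvgMr.
  apply: (squeeze_cvgr _ (cvg_cst 0) cj'); near=> k; apply/andP; split => //.
  by rewrite mulrC ler_pdivlMr// mulrC addnC natrD transition_ge_mul.
have : \sum_j p x j k%:R @[k --> \oo] --> \sum_(j < n) (0 : R).
  by apply: cvg_big => [|j _]; [exact: add_continuous|exact: pj0].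
rewrite big1// (_ : (fun k => _) = cst 1); last first.
  by apply/funext => k /=; exact: p_sum.
by move=> /(cvg_lim (@Rhausdorff R)); rewrite lim_cst// => /eqP; rewrite oner_eq0.
Unshelve. all: by end_near. Qed.

(** As there are finitely many states, one time [T] and one [e] bound the absorption probability
    below from every state. Each further period [T] then leaves at most a fraction [1 - e] of the
    unabsorbed mass. *)
Lemma transient_absorbed_exp a : Q a a = 0 ->
  (forall i, i != a -> transient Pr X i) ->
  exists T : nat, exists2 e, 0 < e <= 1 &
    forall i k, 1 - p i a (k%:R * T%:R) <= (1 - e) ^+ k.
Proof.
move=> Qaa Ta; have /choice[f fP] := transient_reach_absorbing Qaa Ta.
pose T := (\max_i f i)%N.
pose e := \big[Order.min/1]_i p i a T%:R.
have pT i : 0 < p i a T%:R.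
  apply: lt_le_trans (fP i) _; have fT : (f i <= T)%N by exact: leq_bigmax.
  by rewrite -(subnKC fT) natrD transition_to_absorbing_mono.
have ep i : e <= p i a T%:R by exact: bigmin_le_cond.
exists T, e.
  rewrite bigmin_le_id andbT; apply/bigmin_gtP.
  by split => // i _; exact: pT.
move=> i; elim=> [|k IH]; first by rewrite mul0r expr0 gerBl.
have kT : 0 <= k%:R * T%:R :> R by rewrite mulr_ge0.
rewrite -natr1 mulrDl mul1r chapman_kolmogorov//.
have E : 1 - \sum_j p i j (k%:R * T%:R) * p j a T%:R =
    \sum_j p i j (k%:R * T%:R) * (1 - p j a T%:R).
  by rewrite -[X in X - _ = _](p_sum i kT) -sumrB; apply: eq_bigr => j _; rewrite mulrBr mulr1.
(* The absorbed state drops out, so only mass still unabsorbed at time [k T] remains. *)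
rewrite E (bigD1 a)//= absorbing_state// subrr mulr0 add0r.
apply: (@le_trans _ _ (\sum_(j < n | j != a) p i j (k%:R * T%:R) * (1 - e))).
  by apply: ler_sum => j _; rewrite ler_wpM2l// lerB.
have e1 : e <= 1 by exact: bigmin_le_id.
rewrite -mulr_suml exprSr ler_wpM2r ?subr_ge0//.
apply: le_trans IH; have := p_sum i kT; rewrite (bigD1 a)//=; lra.
Qed.

End jump_process.

(** * First hitting times *)

Section hitting_times.
Context (R : realType) (n : nat) d (Omega : measurableType d).
Variables (Pr : 'I_n -> probability Omega R) (X : R -> Omega -> 'I_n).
Variable Q : 'M[R]_n.
Hypothesis XQ : markov_jump_process Pr X Q.
Variable a : 'I_n.

Lemma hitting_time_ge0 w : (0 <= hitting_time X a w)%E.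
Proof. by apply: le_ereal_inf_tmp => _ [t [t0 _] <-]; rewrite lee_fin. Qed.

(** By right-continuity a path in [a] before time [s] stays there for a while and is seen in [a] at
    a rational time before [s]. The countable union makes the event measurable. *)
Lemma hitting_time_lt_bigcup s : [set w | (hitting_time X a w < s%:E)%E] =
  \bigcup_(q in [set q : rat | 0 <= (ratr q : R) < s]) X (ratr q) @^-1` [set a].
Proof.
apply/seteqP; split => w /=.
  move=> /ereal_inf_lt[_ [t [t0 Xt] <-]]; rewrite lte_fin => ts.
  case: XQ => _ [/(_ w t t0) Xr _] _ _ _.
  have : \forall u \near t^'+, X u w = X t w /\ u < s.
    by near=> u; split; [near: u|near: u; exact: nbhs_right_lt].
  case=> e /= e0 He.
  have [|q] := @rat_in_itvoo R t (t + e); first by rewrite ltrDl.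
  rewrite in_itv/= => /andP[tq qe].
  have [|Xq qs] := He (ratr q) _ tq.
    by rewrite /ball/= ltr0_norm; lra.
  exists q => /=; last by rewrite Xq.
  by rewrite qs andbT (le_trans t0)// ltW.
case=> q /= /andP[q0 qs] Xq; apply: le_lt_trans (_ : (_ <= (ratr q)%:E)%E) _.
  by apply: ge_ereal_inf; exists (ratr q)%:E => //; exists (ratr q).
by rewrite lte_fin.
Unshelve. all: by end_near. Qed.

Lemma measurable_hitting_time_lt s :
  measurable [set w | (hitting_time X a w < s%:E)%E].
Proof.
rewrite hitting_time_lt_bigcup bigcup_mkcond; apply: bigcupT_measurable_rat => q.
by case: ifPn => // /set_mem/= /andP[q0 _]; case: XQ => + _ _ _ _; apply.
Qed.

(** A path starting outside [a] keeps its initial state on some interval of length [e], so its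
    hitting time is at least [e]. *)
Lemma hitting_time_le0 : [set w | (hitting_time X a w <= 0)%E] = X 0 @^-1` [set a].
Proof.
apply/seteqP; split => w /=; last first.
  by move=> X0; apply: ge_ereal_inf; exists 0%E => //; exists 0.
move=> h0; apply: contrapT => X0.
case: XQ => _ [/(_ w 0 (lexx _))[e /= e0 He] _] _ _ _.
have : (e%:E <= hitting_time X a w)%E.
  apply: le_ereal_inf_tmp => _ [t [t0 Xt] <-]; rewrite lee_fin leNgt; apply/negP => te.
  apply: X0; move: t0 Xt; rewrite le_eqVlt => /orP[/eqP <-//|t0] <-.
  by apply/esym/He => //; rewrite /ball/= sub0r normrN gtr0_norm.
by move/le_trans/(_ h0); rewrite lee_fin leNgt e0.
Qed.

End hitting_times.

(** * Phase-type laws: positivity and exponential tail *)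

Section phase_type_law.
Context (R : realType) (p : nat) (pi : 'rV[R]_p) (T : 'M[R]_p).
Variable n : probability R R.
Hypothesis n_PH : phase_type pi T n.

(** Absorption at time 0 means starting in state p + 1, whereas under each law of the mixture the
    process almost surely starts in a transient state. *)
Lemma phase_type_gt0 : pr n [set y | y <= 0] = 0.
Proof.
case: n_PH => _ _ [d [Om [Pr [X [XQ _ nE]]]]].
set a := rshift p ord0 in nE.
have mB : measurable ([set y | y <= 0] : set R) by measurable_set.
rewrite /pr (nE _ mB) big1// => i _.
rewrite (_ : _ @^-1` _ = X 0 @^-1` [set a]); last first.
  rewrite -(hitting_time_le0 XQ); apply/seteqP; split => w /=.
    by move=> [y y0 <-]; rewrite lee_fin.
  move=> h0; exists 0 => //; apply/esym/eqP; rewrite eq_le h0.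
  exact: hitting_time_ge0.
have mX j : measurable (X 0 @^-1` [set j]) by case: XQ => + _ _ _ _; apply.
have X0 : pr (Pr (lshift 1 i)) (X 0 @^-1` [set lshift 1 i]) = 1.
  by case: XQ => _ _ XQ0 _ _; rewrite /pr XQ0.
have := pr_le1 (Pr (lshift 1 i)) (measurableU _ _ (mX a) (mX (lshift 1 i))).
rewrite prU//; last first.
  apply/disj_set2P/seteqP; split => w //= [->] /(congr1 val)/= ip.
  by have := ltn_ord i; rewrite -ip addn0 ltnn.
rewrite X0 gerDr => Xa; rewrite prE//.
rewrite (_ : pr _ _ = 0) ?mule0//; apply/eqP.
by rewrite eq_le Xa pr_ge0.
Qed.

Lemma phase_type_tail : exists C l, [/\ 0 < C, 0 < l &
  forall s, 0 <= s -> pr n [set y | s < y] <= C * expR (- (l * s))].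
Proof.
case: n_PH => -[pi0 pi1] _ [d [Om [Pr [X [XQ tX nE]]]]].
set a := rshift p ord0 in nE.
have Qaa : full_intensity T a a = 0 by rewrite block_mxEdr mxE.
have tXa i : i != a -> transient Pr X i.
  by case: (split_ordP i) => j -> //; rewrite ord1 eqxx.
have [N [e /andP[e0 e1] He]] := transient_absorbed_exp XQ Qaa tXa.
have mX q j : 0 <= q -> measurable (X q @^-1` [set j]).
  by case: XQ => + _ _ _ _; apply.
have n_lt s : pr n [set y | y < s] =
    \sum_(i < p) pi 0 i * pr (Pr (lshift 1 i)) [set w | (hitting_time X a w < s%:E)%E].
  have mB : measurable ([set y | y < s] : set R) by measurable_set.
  apply: EFin_inj; rewrite -sumEFin -prE// (nE _ mB); apply: eq_bigr => i _.
  rewrite EFinM -prE; last exact: (measurable_hitting_time_lt XQ).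
  congr (_ * Pr _ _)%E; apply/seteqP; split => w /=.
    by move=> [y ys <-]; rewrite lte_fin.
  move=> hs; have h0 := hitting_time_ge0 X a w.
  exists (fine (hitting_time X a w)).
    by rewrite -lte_fin fineK// ge0_fin_numE// (lt_trans hs)// ltry.
  by rewrite fineK// ge0_fin_numE// (lt_trans hs)// ltry.
(* The periods have length [N.+1] instead of [N]: this covers [N = 0] and makes [k N < s] strict
   once [k > 0], as the event [hitting_time < s] requires. *)
pose l := e / N.+1%:R.
have N0 : 0 < N.+1%:R :> R by [].
(* The constant [expR e] pays for rounding [s / N.+1] down to the integer [k]. *)
exists (expR e), l; split; [exact: expR_gt0|exact: divr_gt0|] => s s0.
have ms : measurable [set y : R | s < y] by measurable_set.
pose k := Num.truncn (s / N.+1%:R).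
have /truncn_itv /andP[ks sk] : 0 <= s / N.+1%:R by rewrite divr_ge0.
apply: (@le_trans _ _ ((1 - e) ^+ k)); last first.
  apply: (@le_trans _ _ (expR (- e) ^+ k)).
    rewrite lerXn2r// ?nnegrE ?expR_ge0 ?subr_ge0//.
    exact: expR_ge1Dx.
  rewrite -expRM_natr -expRD ler_expR /l.
  have -> : e / N.+1%:R * s = e * (s / N.+1%:R) by ring.
  move: sk; rewrite -/k -natr1 => sk; nra.
have [k0|k0] := posnP k; first by rewrite k0 expr0 pr_le1.
have Ns : k%:R * N%:R < s.
  apply: (@lt_le_trans _ _ (k%:R * N.+1%:R)).
    by rewrite ltr_pM2l ?ltr0n// ltr_nat.
  by rewrite -ler_pdivlMr.
have kN0 : 0 <= k%:R * N%:R :> R by rewrite mulr_ge0.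
apply: (@le_trans _ _ (pr n (~` [set y | y < s]))).
  apply: le_pr => //; first by apply: measurableC; measurable_set.
  by move=> y /= sy; apply/negP; rewrite -leNgt ltW.
rewrite pr_setC; last by measurable_set.
have -> : (1 - e) ^+ k = \sum_(i < p) pi 0 i * (1 - e) ^+ k.
  by rewrite -mulr_suml pi1 mul1r.
have -> : 1 - pr n [set y | y < s] = \sum_(i < p) pi 0 i *
    (1 - pr (Pr (lshift 1 i)) [set w | (hitting_time X a w < s%:E)%E]).
  by under eq_bigr do rewrite mulrBr mulr1; rewrite sumrB pi1 n_lt.
apply: ler_sum => i _; rewrite ler_wpM2l//.
apply: le_trans (He (lshift 1 i) k); rewrite lerB// le_pr//.
- exact: mX.
- exact: (measurable_hitting_time_lt XQ).
- move=> w /= Xw; apply: le_lt_trans (_ : (_ <= (k%:R * N%:R)%:E)%E) _.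
    by apply: ge_ereal_inf; exists (k%:R * N%:R)%:E => //; exists (k%:R * N%:R).
  by rewrite lte_fin.
Qed.

End phase_type_law.

(** * Class A *)

Lemma limf_esup_lt1P (R : realType) (f : R -> R) :
  (limf_esup (fun x => (f x)%:E) +oo%R < 1)%E <->
  exists2 r, r < 1 & \forall x \near +oo, f x <= r.
Proof.
split.
  rewrite limf_esupE => /ereal_inf_lt[_ [A FA <-]] s1.
  have fA x : A x -> ((f x)%:E <= ereal_sup [set (f x)%:E | x in A])%E.
    by move=> Ax; apply: ereal_sup_ubound; exists x.
  case: (ereal_sup _) s1 fA => [s||]// s1 fA.
    by exists s => //; apply: filterS FA => x /fA; rewrite lee_fin.
  (* Here the supremum is [-oo], so [A] has no point and any bound works. *)
  by exists 0 => //; apply: filterS FA => x /fA.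
case=> r r1 fr; rewrite limf_esupE.
apply: (@le_lt_trans _ _ r%:E); last by rewrite lte_fin.
apply: ge_ereal_inf.
exists (ereal_sup [set (f x)%:E | x in [set x | f x <= r]]).
  by exists [set x | f x <= r].
by apply: ge_ereal_sup => _ [x /= fx <-]; rewrite lee_fin.
Qed.

Section classA_of_law.
Context d (T : measurableType d) (R : realType) (P : probability T R).
Variable X : {RV P >-> R}.
Let l := distribution P X.
Let Fb x := pr l [set v | x < v].

(** Bridge between the distribution functions of the statement and the laws used in the estimates.
    Positivity of the tail turns the limsup condition into an eventual inequality without
    quotients. *)
Lemma classA_dist_funP : classA (dist_fun P X) <->
  [/\ forall x, x < 0 -> pr l [set v | v <= x] = 0,
      forall x, 0 < Fb x,
      pr (l \x l)%E [set z | x < z.1 + z.2] / Fb x @[x --> +oo] --> (2 : R) &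
      exists2 c, 1 < c &
        exists2 r, r < 1 & \forall x \near +oo, Fb (c * x) <= r * Fb x].
Proof.
have tailE x : tail (dist_fun P X) x = Fb x by exact: tail_dist_fun.
have dE x : dist_fun P X x = pr l [set v | v <= x].
  by rewrite /= /rcdf /cdf -/l; congr (fine (l _));
    apply/seteqP; split => v /=; rewrite in_itv.
have convE : (fun x => tail (convolution (dist_fun P X) (dist_fun P X)) x /
    tail (dist_fun P X) x) = fun x => pr (l \x l)%E [set z | x < z.1 + z.2] / Fb x.
  by apply/funext => x; rewrite tailE tail_convolution_dist_fun.
split.
  move=> [[X0 Xpos Xsub] [c c1 /limf_esup_lt1P[r r1 Xr]]].
  have Fpos x : 0 < Fb x by rewrite -tailE.
  split; [by move=> x x0; rewrite -dE X0|by []|by rewrite -convE|].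
  exists c => //; exists r => //; apply: filterS Xr => x.
  by rewrite !tailE ler_pdivrMr.
move=> [X0 Xpos Xsub [c c1 [r r1 Xr]]]; split.
  split; first by move=> x x0; exact: etrans (dE x) (X0 x x0).
  - by move=> x; rewrite tailE.
  - by rewrite convE.
exists c => //; apply/limf_esup_lt1P; exists r => //; apply: filterS Xr => x.
by rewrite !tailE ler_pdivrMr.
Qed.

Lemma law_tail_cvg0 : Fb x @[x --> +oo] --> 0.
Proof.
rewrite (_ : Fb = (fun x => 1 - dist_fun P X x)); last first.
  by apply/funext => x; rewrite -[RHS]/(tail (dist_fun P X) x) tail_dist_fun.
rewrite -[X in _ --> X](subrr 1); apply: cvgB; first exact: cvg_cst.
exact: cumulativey.
Qed.

End classA_of_law.

(** Otherwise all the sets [1 / (k + 1) <= y] would be null, and so would their union [0 < y], which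
    has mass 1. *)
Lemma pr_gt0_ge (R : realType) (n : probability R R) : pr n [set y | y <= 0] = 0 ->
  exists2 y0, 0 < y0 & 0 < pr n [set y | y0 <= y].
Proof.
move=> n0; apply: contrapT => N.
have ny k : n [set y | k.+1%:R^-1 <= y] = 0%E.
  rewrite prE; last by measurable_set.
  congr EFin; apply/eqP; rewrite eq_le pr_ge0 andbT leNgt; apply/negP => nk.
  by apply: N; exists k.+1%:R^-1; rewrite ?invr_gt0.
have mk k : measurable [set y : R | k.+1%:R^-1 <= y] by measurable_set.
have nU : n (\bigcup_k [set y : R | k.+1%:R^-1 <= y]) = 0%E.
  apply: measure_negligible; first exact: bigcup_measurable.
  apply: negligible_bigcup => k; exists [set y : R | k.+1%:R^-1 <= y]; split.
  - exact: mk.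
  - exact: ny.
  - by [].
move: nU.
rewrite (_ : \bigcup_k _ = ~` [set y | y <= 0]).
  rewrite prE; last by apply: measurableC; measurable_set.
  rewrite pr_setC ?n0 ?subr0; last by measurable_set.
  by case=> /eqP; rewrite oner_eq0.
apply/seteqP; split => y /=.
  move=> [k _ /= ky]; apply/negP; rewrite -ltNge.
  by apply: lt_le_trans ky; rewrite invr_gt0.
move=> /negP; rewrite -ltNge => /ltr_add_invr[k]; rewrite add0r => ky.
by exists k => //=; exact: ltW.
Qed.

(** * The law of a product of independent variables *)

Section product_of_independent.
Context (R : realType) d (Omega : measurableType d) (P : probability Omega R).
Variables V Y : {RV P >-> R}.
Hypothesis VY_indep : independent_rv P V Y.

Let m := distribution P V.
Let n := distribution P Y.

Let J : Omega -> R * R := fun w => (V w, Y w).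

Let mJ : measurable_fun setT J.
Proof. exact: measurable_fun_pair. Qed.

#[local] HB.instance Definition _ := @isMeasurableFun.Build _ _ _ _ J mJ.

(** Independence is the equality on rectangles, which determines the product measure. *)
Lemma joint_law A : measurable A -> P (J @^-1` A) = (m \x n)%E A.
Proof.
move=> mA; apply/esym.
rewrite -[RHS]/(distribution P J A).
apply: product_measure_unique mA => B C mB mC; exact: VY_indep.
Qed.

Let W : {RV P >-> R} := (V : {mfun Omega >-> R}) * Y.
Let l := distribution P W.

Lemma product_law_tail t :
  pr l [set z | t < z] = pr (m \x n)%E [set z | t < z.1 * z.2].
Proof. by rewrite /pr -joint_law//; measurable_set. Qed.

(** Each factor [l] is the image of the joint law [m \x n] under multiplication; two changes of
    variables reduce the claim to [sum_of_products_tail]. *)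
Lemma product_law_sum_tail t : (l \x l)%E [set z | t < z.1 + z.2] =
  (\int[n]_y \int[n]_y' (m \x m) [set z | (t < z.1 * y + z.2 * y')%R])%E.
Proof.
rewrite -sum_of_products_tail.
pose A := [set z : (R * R) * (R * R) | t < z.1.1 * z.1.2 + z.2.1 * z.2.2].
have mA : measurable A.
  rewrite /A; apply: measurable_set_lt => //.
  by apply: measurable_funD; apply: measurable_funM; apply: measurableT_comp.
have mg : measurable_fun setT (fun u : R * R =>
    (m \x n)%E [set w | t < u.1 * u.2 + w.1 * w.2]).
  have := measurable_fun_xsection ((m \x n)%E : probability (R * R)%type R) mA.
  apply: eq_measurable_fun => u _ /=.
  by congr ((m \x n)%E _); apply/seteqP; split => v; rewrite /xsection/= inE.
transitivity (\int[distribution P J]_u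
    (m \x n)%E [set w | (t < u.1 * u.2 + w.1 * w.2)%R])%E; last first.
  by apply: eq_measure_integral => B mB _; exact: joint_law.
rewrite ge0_integral_distribution//.
rewrite /product_measure1 ge0_integral_distribution//; last first.
  exact: (measurable_fun_xsection l (measurable_sum_gt t)).
apply: eq_integral => w _ /=.
apply: etrans (joint_law _); last by measurable_set.
by congr (P _); apply/seteqP; split => v; rewrite /xsection/= inE.
Qed.

End product_of_independent.

(** * Comparison of the tails of V, Y and VY *)

Section product_tail_asymptotics.
Context (R : realType) (m n : probability R R).

Let Fb x := pr m [set v | x < v].
Let Hb t := pr (m \x n)%E [set z | t < z.1 * z.2].

Hypothesis n_gt0 : pr n [set y | y <= 0] = 0.
Hypothesis Fb_gt0 : forall x, 0 < Fb x.

(** On [y0 <= Y], an event of positive mass [k], [t / y0 < V] already forces [t < VY]. *)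
Lemma product_tail_ge : exists y0 k, [/\ 0 < y0, 0 < k &
  forall t, 0 <= t -> k * Fb (t / y0) <= Hb t].
Proof.
have [y0 y00 k0] := pr_gt0_ge n_gt0.
exists y0, (pr n [set y | y0 <= y]); split => // t t0.
rewrite mulrC -pr_setX; do ?by measurable_set.
apply: le_pr; do ?by measurable_set.
move=> -[v y] /= []; rewrite ltr_pdivrMr// => tv yy; apply: (lt_le_trans tv).
by rewrite ler_wpM2l// ltW//; apply: contraTT tv; rewrite -!leNgt => v0; nra.
Qed.

Lemma product_tail_gt0 t : 0 < Hb t.
Proof.
have [y0 [k [y00 k0 Hk]]] := product_tail_ge.
have t0 : 0 <= Num.max t 0 by rewrite le_max lexx orbT.
apply: lt_le_trans (le_trans (Hk _ t0) _); first by rewrite mulr_gt0.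
apply: le_pr; do ?by measurable_set.
by move=> z /=; apply: le_lt_trans; rewrite le_max lexx.
Qed.

Hypothesis m_ge0 : pr m [set v | v < 0] = 0.

Lemma product_ge0 : pr (m \x n)%E [set z | 0 <= z.1 * z.2] = 1.
Proof.
apply/eqP; rewrite eq_le pr_le1 /=; last by measurable_set.
apply: (@le_trans _ _ (pr (m \x n)%E (~` [set v | v < 0] `*` ~` [set y | y <= 0]))).
  rewrite pr_setX; do ?[by apply: measurableC; measurable_set].
  rewrite !pr_setC; do ?by measurable_set.
  by rewrite m_ge0 n_gt0 subr0 mulr1.
apply: le_pr; [|by measurable_set|].
  by apply: measurableX; apply: measurableC; measurable_set.
move=> [v y] /= [/negP + /negP]; rewrite -leNgt -ltNge => v0 y0.
by rewrite mulr_ge0// ltW.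
Qed.

Hypothesis Fb_cvg0 : Fb x @[x --> +oo] --> 0.
Hypothesis Fb_sub :
  pr (m \x m)%E [set z | x < z.1 + z.2] / Fb x @[x --> +oo] --> (2 : R).
Hypothesis n_exp : exists C l, [/\ 0 < C, 0 < l &
  forall s, 0 <= s -> pr n [set y | s < y] <= C * expR (- (l * s))].

(** The left-hand side decays exponentially in [t], while [Hb t] is at least a multiple of
    [Fb (t / y0)], which eventually dominates every exponential. *)
Lemma multiplier_little_o M e : 0 < M -> 0 < e ->
  \forall t \near +oo, pr n [set y | t < M * y] <= e * Hb t.
Proof.
move=> M0 e0; have [C [l [C0 l0 HC]]] := n_exp.
have [y0 [k [y00 k0 Hk]]] := product_tail_ge.
(* This rate at the point [t / y0] is the rate [l] at [t / M]. *)
have l'0 : 0 < l * y0 / M by rewrite divr_gt0// mulr_gt0.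
have e'0 : 0 < e * k / C by rewrite divr_gt0// mulr_gt0.
have /near_pinftyP[x0 x00 Hx0] := exp_little_o_tail m_ge0 Fb_gt0 Fb_cvg0 Fb_sub l'0 e'0.
apply/near_pinftyP; exists (x0 * y0); first exact: mulr_gt0.
move=> t xt; have t0 : 0 <= t by rewrite (le_trans _ xt)// mulr_ge0// ltW.
have -> : [set y : R | t < M * y] = [set y | t / M < y].
  by apply/seteqP; split => y /=; rewrite ltr_pdivrMr// mulrC.
have tM : 0 <= t / M by rewrite divr_ge0// ltW.
apply: (le_trans (HC _ tM)).
have /Hx0 : x0 <= t / y0 by rewrite ler_pdivlMr.
have -> : l * y0 / M * (t / y0) = l * (t / M) by field; rewrite !gt_eqF.
move=> E; have := ler_wpM2l (ltW C0) E => /le_trans; apply.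
have -> : C * (e * k / C * Fb (t / y0)) = e * (k * Fb (t / y0)).
  by field; rewrite gt_eqF.
by apply: ler_wpM2l; [exact: ltW|exact: Hk].
Qed.

End product_tail_asymptotics.

Theorem corollary3p13 (R : realType) (d : measure_display)
    (Omega : measurableType d) (P : probability Omega R)
    (V Y : {RV P >-> R}) (p : nat) (pi : 'rV[R]_p) (T : 'M[R]_p)
    (V_ge0 : {ae P, forall w, 0 <= V w})
    (Y_PH : phase_type pi T (distribution P Y))
    (VY_indep : independent_rv P V Y)
    (V_A : classA (dist_fun P V)) :
  classA (dist_fun P ((V : {mfun Omega >-> R}) * Y)).
Proof.
set W : {RV P >-> R} := (V : {mfun Omega >-> R}) * Y.
pose m := distribution P V; pose n := distribution P Y; pose l := distribution P W.
pose Hb t := pr (m \x n)%E [set z | t < z.1 * z.2].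
have lE t : pr l [set z | t < z] = Hb t by exact: product_law_tail.
have n0 : pr n [set y | y <= 0] = 0 := phase_type_gt0 Y_PH.
have nexp := phase_type_tail Y_PH.
have /classA_dist_funP[_ Fpos Fsub [c c1 [r r1 Fr]]] := V_A.
have F0 := law_tail_cvg0 V.
have m0 : pr m [set v | v < 0] = 0.
  have mB : measurable [set v : R | v < 0] by measurable_set.
  rewrite /pr (_ : m _ = 0%E)//.
  case: V_ge0 => A [mA A0 VA].
  apply: (@measure_negligible _ _ _ P (V @^-1` _)).
    exact: (measurable_funPTI V mB).
  exists A; split=> // w /= Vw; apply: VA => /=; apply/negP.
  by rewrite -ltNge.
have Hpos t : 0 < Hb t := product_tail_gt0 n0 Fpos t.
have Hlo := multiplier_little_o n0 Fpos m0 F0 Fsub nexp.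
have lpos : pr l [set z | 0 <= z] = 1.
  by rewrite -(product_ge0 n0 m0) /pr -joint_law//; measurable_set.
have l0 x : x < 0 -> pr l [set v | v <= x] = 0.
  move=> x0; apply/eqP; rewrite eq_le pr_ge0 andbT.
  have -> : 0 = pr l (~` [set z | 0 <= z]).
    by rewrite pr_setC ?lpos ?subrr//; measurable_set.
  apply: le_pr; [by measurable_set|by apply: measurableC; measurable_set|].
  by move=> v /= vx; apply/negP; rewrite -ltNge (le_lt_trans vx).
pose S t := pr (l \x l)%E [set z | t < z.1 + z.2].
have S_le e : 0 < e -> \forall t \near +oo, S t <= (2 + e) * Hb t.
  (* With [e / 4] both in the kernel bound and for large weights, the doubled sum is
     [2 * (1 + e / 4 + e / 4) = 2 + e]. *)
  move=> e0; have e4 : 0 < e / 4 by rewrite divr_gt0.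
  have Fscale : forall e, 0 < e -> exists2 k, 1 <= k &
      \forall x \near +oo, pr m [set v | k * x < v] <= e * pr m [set v | x < v].
    by move=> e' e'0; apply: tail_scale Fr.
  have [M M0 HM] := weighted_sum_tail m0 Fpos F0 Fsub Fscale e4.
  near=> t.
  have nt : pr n [set y | t < M * y] <= e / 4 * Hb t by near: t; exact: Hlo.
  have := sum_of_products_le n0 (ltW e4) (HM t).
  rewrite -product_law_sum_tail// prE; last exact: measurable_sum_gt.
  by rewrite lee_fin; rewrite -/(S t) -/(Hb t); lra.
have H0 e : 0 < e -> \forall t \near +oo, Hb t <= e.
  move=> e0; have /cvgrPdist_le/(_ e e0) := law_tail_cvg0 W.
  by apply: filterS => t; rewrite lE sub0r normrN ger0_norm// ltW.
apply/classA_dist_funP; split => //.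
- by move=> x; rewrite lE.
(* The upper bound is [S_le]; below, [sum2_tail_ge] gives [2 - Hb t <= S t / Hb t], and [Hb t] tends
   to 0. *)
- apply/cvgrPdist_le => e e0; near=> t.
  rewrite lE -/(S t).
  have t0 : 0 <= t by near: t; exact: (nbhs_pinfty_ge (num_real _)).
  have Hte : Hb t <= e by near: t; exact: H0.
  have St : S t <= (2 + e) * Hb t by near: t; exact: S_le.
  have : S t / Hb t <= 2 + e by rewrite ler_pdivrMr.
  have := sum2_tail_ge lpos t0; rewrite lE -/(S t) -mulrBl -ler_pdivlMr//.
  by move=> ? ?; rewrite ler_norml; apply/andP; split; lra.
have /near_pinftyP[M M0 HM] := Fr.
have r0 : 0 <= r.
  have := HM M (lexx _); have := Fpos M; have := Fpos (c * M); nra.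
(* The midpoint between [r] and 1 leaves the margin [(1 - r) / 2] for the contribution of large
   weights. *)
exists c => //; exists ((r + 1) / 2); first by lra.
near=> t; rewrite !lE.
apply: (le_trans (product_tail_scale n0 t r0 HM)).
have : pr n [set y | t < M * y] <= (1 - r) / 2 * Hb t.
  by near: t; apply: Hlo => //; lra.
by rewrite -/(Hb t); lra.
Unshelve. all: by end_near. Qed.
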